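(* Let $R_1$ be the unique solution in $]0,1[$ of $$\sum_{n=1}^{\infty}\frac{4R^n}{1+R^{2n}}=1$$ and let $R_0$ be the unique solution in $]0,1[$ of $$\sum_{n\ge 1,\ n\text{ even}}\frac{4R^n}{1+R^{2n}}+\sum_{n\ge1,\ n\text{ odd}}\frac{4R^n}{1-R^{2n}}=1.$$ Let $0<R<1$ and let $\mathscr E=\mathscr E_R$. 1) If $R>R_1$, then the Bohr phenomenon does not hold for the ellipse $\mathscr E$ in the class of holomorphic functions with real coefficients. 2) If $R>R_0$, then the Bohr phenomenon does not hold for the ellipse $\mathscr E$ in the class of all holomorphic functions.
   Context: Let $K=[-1,1]\subset\mathbb C$. For $0<R<1$, $\mathscr E=\mathscr E_R$ is the open domain bounded by the ellipse $\{\tfrac12(\tfrac wR+\tfrac Rw): |w|=1\}$ with foci $\pm1$; thus $\mathscr E\setminus K=\{\tfrac12(\tfrac wR+\tfrac Rw): R<|w|<1\}$. The Faber polynomials of $\mathscr E$ are the polynomials $F_{\mathscr E,0}=1$ and, for $n\ge1$, $F_{\mathscr E,n}$ determined by $F_{\mathscr E,n}\big(\tfrac12(\tfrac wR+\tfrac Rw)\big)=w^n+R^{2n}w^{-n}$; in particular $\sup_K|F_{\mathscr E,n}|=2R^n$ for $n\ge 1$. Every $f$ holomorphic on $\mathscr E$ has a unique expansion $f=\sum_{n\ge0}a_nF_{\mathscr E,n}$, $a_n\in\mathbb C$, converging uniformly on compact subsets of $\mathscr E$. ''With real coefficients'' means that all $a_n$ in this expansion are real. The Bohr phenomenon holds for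 $\mathscr E$ in a given class of holomorphic functions if for every $f=\sum_{n\ge 0}a_nF_{\mathscr E,n}$ in this class with $|f(z)|<1$ for all $z\in\mathscr E$, one has $\sum_{n\ge0}|a_n|\sup_K|F_{\mathscr E,n}|<1$. *)

(* Defs.v *)
From HB Require Import structures.
From mathcomp Require Import all_boot all_order all_algebra.
From mathcomp Require Import complex.
From mathcomp Require Import all_classical all_reals all_analysis.
From mathcomp Require Import ring lra.
Set Implicit Arguments.
Unset Strict Implicit.
Unset Printing Implicit Defensive.
Import Order.TTheory GRing.Theory Num.Theory.
Import numFieldNormedType.Exports.
Import ComplexField.Normc.
Local Open Scope classical_set_scope.
Local Open Scope ring_scope.
Local Open Scope complex_scope.

(* The metric topology of the absolute value of [R[i]]; with it, [derivable]
   over the scalar field [R[i]] is complex differentiability. *)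
HB.instance Definition _ (R : rcfType) := NormedModule.copy R[i] R[i]^o.

Section Defs.
Variable R : realType.
Implicit Types (r : R) (z w : R[i]) (n : nat) (p : {poly R[i]}).
Implicit Types (f : R[i] -> R[i]) (a : nat -> R[i]).

(* [normc] is the modulus with values in [R]; the norm [`|z|] of [R[i]] is
   [(normc z)%:C], see [normC_normc]. *)

Definition K : set R[i] := [set x%:C | x in `[-1, 1]%classic].

Definition joukowski r w : R[i] := 2^-1 * (w / r%:C + r%:C / w).

Definition ellipse r : set R[i] :=
  [set joukowski r w | w in [set w | normc w = 1]].

(* The foci are -1 and 1 and the sum of the focal distances on the ellipse is
   r^-1 + r ([ellipseE]). This set is open and its boundary is the ellipse
   ([open_ellipse_domain], [ellipse_domain_boundary]); minus K, it is the
   image of the annulus r < |w| < 1 ([ellipse_domainDK]). *)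
Definition ellipse_domain r : set R[i] :=
  [set z | normc (z - 1) + normc (z + 1) < r^-1 + r].

(* For 0 < r and 0 < n, exactly one polynomial satisfies the identity
   ([faberE], [faber_unique]), so the default value of [xget] is not used. *)
Definition faber r n : {poly R[i]} :=
  if n is 0 then 1 else
  xget 0 [set p | forall w, w != 0 ->
                  p.[joukowski r w] = w ^+ n + (r ^+ (2 * n))%:C * w ^- n].

Definition holomorphic_on (D : set R[i]) f := forall z, D z -> derivable f z 1.

(* f is the sum of the a_n F_n, uniformly on the compact subsets of the domain. *)
Definition faber_expansion r a f :=
  forall A : set R[i], compact A -> A `<=` ellipse_domain r ->
    {uniform A, (fun N z => \sum_(0 <= n < N) a n * (faber r n).[z]) @ \oo --> f}.

Definition holomorphic_class r : set (R[i] -> R[i]) :=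
  [set f | holomorphic_on (ellipse_domain r) f].

Definition real_coefficients_class r : set (R[i] -> R[i]) :=
  [set f | holomorphic_on (ellipse_domain r) f /\
    exists2 a, faber_expansion r a f & forall n, a n \is Num.real].

(* The last sum is in the extended reals: a divergent series is +oo and
   violates the inequality. *)
Definition bohr_phenomenon r (F : set (R[i] -> R[i])) :=
  forall f a, F f -> faber_expansion r a f ->
    (forall z, ellipse_domain r z -> normc (f z) < 1) ->
    (\sum_(0 <= n <oo)
       (normc (a n) * sup [set normc (faber r n).[z] | z in K])%:E < 1)%E.

Lemma realC_neq0 r : 0 < r -> r%:C != 0 :> R[i].
Proof.
by move=> r0; rewrite (_ : 0 = 0%:C) // (inj_eq (@complexI R)) gt_eqF.
Qed.

Lemma joukowski_surj r z : 0 < r -> exists2 w, w != 0 & z = joukowski r w.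
Proof.
move=> r0; have rC := realC_neq0 r0.
pose w := r%:C * (z + sqrtC (z ^+ 2 - 1)).
have hw : w ^+ 2 - 2 * r%:C * z * w + r%:C ^+ 2 = 0.
  have /(_ (z ^+ 2 - 1)) := @sqrtCK R[i]; rewrite /w.
  set s := sqrtC _ => hs.
  have -> : (r%:C * (z + s)) ^+ 2 - 2 * r%:C * z * (r%:C * (z + s)) + r%:C ^+ 2
            = r%:C ^+ 2 * (s ^+ 2 - (z ^+ 2 - 1)) by ring.
  by rewrite hs subrr mulr0.
have w0 : w != 0.
  apply/eqP => w0; move: hw; rewrite w0 expr0n /= mulr0 subrr add0r => /eqP.
  by rewrite expf_eq0 /= (negPf rC).
exists w => //; rewrite /joukowski.
have -> : 2^-1 * (w / r%:C + r%:C / w) = z + (2 * r%:C * w)^-1 *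
   (w ^+ 2 - 2 * r%:C * z * w + r%:C ^+ 2).
  by field; rewrite rC w0.
by rewrite hw mulr0 addr0.
Qed.

Lemma faber_exists r n : 0 < r -> exists p, forall w, w != 0 ->
  p.[joukowski r w] = w ^+ n + (r ^+ (2 * n))%:C * w ^- n.
Proof.
move=> r0; have rC := realC_neq0 r0.
pose P n p := forall w, w != 0 ->
  p.[joukowski r w] = w ^+ n + (r ^+ (2 * n))%:C * w ^- n.
suff : exists p q, P n p /\ P n.+1 q by case=> p [q [? _]]; exists p.
elim: n => [|n [p [q [Pp Pq]]]].
  exists 2%:P, ((2 * r%:C) *: 'X); split => w w0.
    by rewrite hornerC expr0 muln0 expr0 invr1 mulr1.
  rewrite !hornerE /joukowski rmorphXn /=.
  by field; rewrite rC w0.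
exists q, ((2 * r%:C) *: ('X * q) - (r%:C ^+ 2) *: p); split => // w w0.
have {Pp} := Pp w w0; have {Pq} := Pq w w0.
have wn0 : w ^+ n != 0 by rewrite expf_neq0.
rewrite !hornerE => -> ->; rewrite /joukowski !rmorphXn /= !mulnS !exprD !exprS.
rewrite expr0 mulr1 !invfM; move: (w ^+ n) wn0 => x x0.
by field; rewrite rC w0 x0.
Qed.

Lemma horner_inj p q : (forall z, p.[z] = q.[z]) -> p = q.
Proof.
move=> pq; apply/eqP; rewrite -subr_eq0; apply: contraT => d0.
pose s : seq R[i] := [seq i%:R | i <- iota 0 (size (p - q))].
have := @max_poly_roots _ (p - q) s d0; rewrite size_map size_iota ltnn.
apply.
  by apply/allP => z _; rewrite rootE !hornerE pq subrr.
rewrite map_inj_uniq ?iota_uniq // => i j /eqP.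
by rewrite eqr_nat => /eqP.
Qed.

Lemma faberE r n w : 0 < r -> (0 < n)%N -> w != 0 ->
  (faber r n).[joukowski r w] = w ^+ n + (r ^+ (2 * n))%:C * w ^- n.
Proof.
case: n => // n r0 _; move: w; rewrite /faber.
case: xgetP => [p _ //|nP]; have [p Pp] := faber_exists n.+1 r0.
by have := nP p; rewrite /= => /(_ Pp).
Qed.

Lemma faber_unique r n p : 0 < r -> (0 < n)%N ->
  (forall w, w != 0 ->
     p.[joukowski r w] = w ^+ n + (r ^+ (2 * n))%:C * w ^- n) ->
  p = faber r n.
Proof.
move=> r0 n0 Pp; apply: horner_inj => z.
by have [w w0 ->] := joukowski_surj z r0; rewrite Pp// faberE.
Qed.

Lemma normC_normc z : `|z| = (normc z)%:C.
Proof. by case: z => x y; rewrite normc_def. Qed.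

Lemma normc_ge0 z : 0 <= normc z.
Proof. by case: z => x y; exact: sqrtr_ge0. Qed.

Lemma normc_gt0 z : z != 0 -> 0 < normc z.
Proof.
move=> z0; rewrite lt_neqAle normc_ge0 andbT eq_sym.
by apply: contra z0 => /eqP /eq0_normc ->.
Qed.

Lemma normcR r : normc r%:C = `|r|.
Proof. by rewrite /normc /= expr0n /= addr0 sqrtr_sqr. Qed.

Lemma sqr_normcE (x y : R) : normc (x +i* y) ^+ 2 = x ^+ 2 + y ^+ 2.
Proof. by rewrite /normc sqr_sqrtr // addr_ge0 ?sqr_ge0. Qed.

Lemma focal_sum_joukowski r w : 0 < r -> w != 0 ->
  normc (joukowski r w - 1) + normc (joukowski r w + 1)
  = normc w / r + r / normc w.
Proof.
move=> r0 w0; have rC := realC_neq0 r0; have nw0 := normc_gt0 w0.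
have -> : joukowski r w - 1 = (w - r%:C) ^+ 2 / (2 * r%:C * w).
  by rewrite /joukowski; field; rewrite rC w0.
have -> : joukowski r w + 1 = (w + r%:C) ^+ 2 / (2 * r%:C * w).
  by rewrite /joukowski; field; rewrite rC w0.
rewrite !expr2 !normcM !normcV !normcM -!expr2.
have -> : normc (2 : R[i]) = 2.
  by rewrite (_ : 2 = 2%:C) ?normcR ?ger0_norm// rmorph_nat.
rewrite (normcR r) (gtr0_norm r0).
have -> : normc (w - r%:C) ^+ 2 =
  normc w ^+ 2 + r ^+ 2 - (normc (w + r%:C) ^+ 2 - normc w ^+ 2 - r ^+ 2).
  case: (w) => x y; rewrite (_ : r%:C = r +i* 0)//; simpc.
  by rewrite !sqr_normcE; ring.
by field; rewrite !gt_eqF.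
Qed.

Lemma joukowski_swap r w : 0 < r -> w != 0 ->
  joukowski r (r%:C ^+ 2 / w) = joukowski r w.
Proof.
move=> r0 w0; rewrite /joukowski; field.
by rewrite w0 realC_neq0.
Qed.

Lemma joukowski_annulus r z : 0 < r ->
  exists w, [/\ w != 0, z = joukowski r w & r <= normc w].
Proof.
move=> r0; have [w w0 ->] := joukowski_surj z r0.
have [rw|rw] := leP r (normc w); first by exists w.
exists (r%:C ^+ 2 / w); rewrite joukowski_swap//; split=> //.
  by rewrite mulf_neq0 ?expf_neq0 ?invr_eq0 ?realC_neq0.
rewrite expr2 !normcM normcV normcR gtr0_norm// ler_pdivlMr ?normc_gt0//.
by rewrite ler_pM2l// ltW.
Qed.

Lemma joukowski_K r w : 0 < r -> normc w = r -> K (joukowski r w).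
Proof.
case: w => x y r0 nw; have := sqr_normcE x y; rewrite nw => e.
have w0 : x +i* y != 0.
  by apply/eqP => w0; move: nw r0; rewrite w0 normc0 => ->; rewrite ltxx.
exists (x / r).
  rewrite /= in_itv /= ler_pdivlMr// ler_pdivrMr//; apply/andP; split; nra.
have rw : r%:C / (x +i* y) = (x -i* y) / r%:C.
  apply/eqP; rewrite eqr_div ?realC_neq0// -expr2 -rmorphXn /= e.
  by simpc; rewrite !expr2; apply/eqP; congr Complex; ring.
rewrite /joukowski rw -mulrDl.
have -> : x +i* y + x -i* y = 2 * x%:C.
  by rewrite mulr_natl mulr2n; apply/eqP; rewrite eq_complex /= subrr addr0 !eqxx.
rewrite rmorphM /= fmorphV mulrA mulrA mulVf ?mul1r//.
Qed.

Lemma focal_sum_K z : K z -> normc (z - 1) + normc (z + 1) = 2.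
Proof.
case=> x; rewrite /= in_itv /= => /andP[x1 x2] <-.
have -> : x%:C - 1 = (x - 1)%:C by rewrite rmorphB.
have -> : x%:C + 1 = (x + 1)%:C by rewrite rmorphD.
rewrite !normcR ler0_norm ?ger0_norm; lra.
Qed.

Lemma ellipseE r : 0 < r < 1 ->
  ellipse r = [set z | normc (z - 1) + normc (z + 1) = r^-1 + r].
Proof.
case/andP=> r0 r1; apply/seteqP; split => z /=.
  case=> w /= nw <-; have w0 : w != 0.
    by apply/eqP => w0; move: nw; rewrite w0 normc0 => /eqP; rewrite eq_sym oner_eq0.
  by rewrite focal_sum_joukowski// nw div1r divr1.
have [w [w0 -> rw]] := joukowski_annulus z r0.
rewrite focal_sum_joukowski// => e; exists w => //=.
have nw0 := normc_gt0 w0; have rn0 : r != 0 by rewrite gt_eqF.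
have nwn0 : normc w != 0 by rewrite gt_eqF.
have /eqP : (normc w - 1) * (normc w - r ^+ 2) = 0.
  have -> : (normc w - 1) * (normc w - r ^+ 2) =
     r * normc w * ((normc w / r + r / normc w) - (r^-1 + r)).
    by field; rewrite nwn0 rn0.
  by rewrite e subrr mulr0.
rewrite mulf_eq0 => /orP[|]; rewrite subr_eq0 => /eqP // e'.
by nra.
Qed.

Lemma ellipse_domainDK r : 0 < r < 1 ->
  ellipse_domain r `\` K = [set joukowski r w | w in [set w | r < normc w < 1]].
Proof.
case/andP=> r0 r1; have rn0 : r != 0 by rewrite gt_eqF.
have key (t : R) : 0 < t ->
  (t / r + r / t < r^-1 + r) = ((t - 1) * (t - r ^+ 2) < 0).
  move=> t0; have -> : (t - 1) * (t - r ^+ 2) =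
     r * t * ((t / r + r / t) - (r^-1 + r)) by field; rewrite !gt_eqF.
  by rewrite pmulr_rlt0 ?mulr_gt0// subr_lt0.
apply/seteqP; split => z.
  case=> + nK; have [w [w0 zw rw]] := joukowski_annulus z r0.
  rewrite zw /ellipse_domain /= focal_sum_joukowski// key ?normc_gt0// => h.
  exists w => //=; apply/andP; split.
    rewrite lt_neqAle rw andbT; apply/eqP => e.
    by apply: nK; rewrite zw; exact: joukowski_K.
  have w2 : 0 < normc w - r ^+ 2.
    by rewrite subr_gt0 (lt_le_trans _ rw)// expr2 gtr_pMl.
  by move: h; rewrite pmulr_llt0// subr_lt0.
case=> w /= /andP[rw w1] <-.
have nw0 : 0 < normc w by exact: lt_trans rw.
have w0 : w != 0 by apply/eqP => e; move: nw0; rewrite e normc0 ltxx.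
split.
  rewrite /ellipse_domain /= focal_sum_joukowski// key//.
  have w2 : 0 < normc w - r ^+ 2.
    by rewrite subr_gt0 (lt_trans _ rw)// expr2 gtr_pMl.
  by rewrite pmulr_llt0// subr_lt0.
move=> /focal_sum_K; rewrite focal_sum_joukowski// => e.
have : (normc w - r) ^+ 2 = 0.
  have -> : (normc w - r) ^+ 2 = r * normc w * (normc w / r + r / normc w - 2).
    by field; rewrite rn0 gt_eqF.
  by rewrite e subrr mulr0.
by move/eqP; rewrite sqrf_eq0 subr_eq0 => /eqP e'; rewrite e' ltxx in rw.
Qed.

Lemma focal_sum0 r : 0 < r < 1 -> 2 < r^-1 + r.
Proof.
case/andP=> r0 r1; rewrite -subr_gt0.
have -> : r^-1 + r - 2 = (1 - r) ^+ 2 / r by field; rewrite gt_eqF.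
by rewrite divr_gt0// exprn_gt0// subr_gt0.
Qed.

Lemma sub_K_ellipse_domain r : 0 < r < 1 -> K `<=` ellipse_domain r.
Proof. by move=> r01 z /focal_sum_K; rewrite /ellipse_domain /= => ->; exact: focal_sum0. Qed.

Lemma normc_continuous : continuous (@normc R).
Proof.
move=> z; apply/(@cvgrPdist_lt _ _ _ (nbhs z)) => e e0.
have e0' : 0 < e%:C :> R[i] by rewrite ltcR.
apply/nbhs_ballP; exists e%:C => //= w.
rewrite -ball_normE /= normC_normc ltcR; apply: le_lt_trans.
have := ler_dist_dist z w.
rewrite !normC_normc.
have -> : (normc z)%:C - (normc w)%:C = (normc z - normc w)%:C :> R[i].
  by rewrite rmorphB.
by rewrite normcR lecR.
Qed.

Lemma focal_sum_continuous :
  continuous (fun z => normc (z - 1) + normc (z + 1) : R).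
Proof.
move=> z; apply: (@cvgD _ _ _ (nbhs z)).
  apply: (@continuous_comp _ _ _ (fun z : R[i] => z - 1)); last exact: normc_continuous.
  by rewrite /continuous_at; apply: (@cvgB _ _ _ (nbhs z) _ id (cst 1)); [exact: cvg_id|exact: cvg_cst].
apply: (@continuous_comp _ _ _ (fun z : R[i] => z + 1)); last exact: normc_continuous.
by rewrite /continuous_at; apply: (@cvgD _ _ _ (nbhs z) _ id (cst 1)); [exact: cvg_id|exact: cvg_cst].
Qed.

Lemma open_ellipse_domain r : open (ellipse_domain r).
Proof.
apply: (@open_comp _ _ (fun z => normc (z - 1) + normc (z + 1)) [set x | x < r^-1 + r]).
  by move=> z _; exact: focal_sum_continuous.
exact: open_lt.
Qed.

Lemma ellipse_domain_boundary r : 0 < r < 1 ->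
  closure (ellipse_domain r) `\` ellipse_domain r = ellipse r.
Proof.
move=> r01; rewrite ellipseE//; apply/seteqP; split => z /=.
  case=> cz nz; apply/eqP; rewrite eq_le [X in _ && X]leNgt (introN idP nz) andbT.
  have : closed [set z | normc (z - 1) + normc (z + 1) <= r^-1 + r].
    apply: (@closed_comp _ _ (fun z => normc (z - 1) + normc (z + 1)) [set x | x <= r^-1 + r]).
      by move=> y _; exact: focal_sum_continuous.
    exact: closed_le.
  move/closure_id => cl.
  have : closure [set z | normc (z - 1) + normc (z + 1) <= r^-1 + r] z.
    by apply: closureS cz => y; rewrite /ellipse_domain /= => /ltW.
  by rewrite -cl.
move=> ez; split; last by rewrite /ellipse_domain /= ez ltxx.
have h2 := focal_sum0 r01.
have tE (t : R) : 0 <= t < 1 -> ellipse_domain r (t%:C * z).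
  case/andP=> t0 t1; rewrite /ellipse_domain /=.
  have t1' : 0 <= 1 - t by rewrite subr_ge0 ltW.
  have -> : t%:C * z - 1 = t%:C * (z - 1) - (1 - t)%:C by rewrite rmorphB /=; ring.
  have -> : t%:C * z + 1 = t%:C * (z + 1) + (1 - t)%:C by rewrite rmorphB /=; ring.
  have := le_normcD (t%:C * (z - 1)) (- (1 - t)%:C).
  have := le_normcD (t%:C * (z + 1)) (1 - t)%:C.
  rewrite normcN !normcM !normcR (ger0_norm t0) (ger0_norm t1').
  move: ez h2; nra.
move=> B /nbhs_ballP[e /= e0 eB].
have [d d0 ed] : exists2 d : R, 0 < d & e = d%:C.
  case: e e0 {eB} => x y; rewrite ltcE /= => /andP[/eqP -> x0].
  by exists x.
have z0 := normc_ge0 z.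
pose u := d / (2 * (d + normc z)).
have dz : 0 < 2 * (d + normc z) by lra.
have u0 : 0 < u by rewrite divr_gt0.
have u1 : u < 1 by rewrite ltr_pdivrMr//; lra.
exists ((1 - u)%:C * z); split; first by apply: tE; lra.
apply: eB; rewrite -ball_normE /= ed.
have -> : z - (1 - u)%:C * z = u%:C * z by rewrite rmorphB /=; ring.
rewrite normC_normc normcM normcR gtr0_norm// ltcR /u mulrAC ltr_pdivrMr//.
rewrite ltr_pM2l//; lra.
Qed.

End Defs.

(* Main.v *)
Require Import Defs.
From mathcomp Require Import all_boot all_order all_algebra.
From mathcomp Require Import all_classical all_reals all_analysis.
From mathcomp Require Import ring lra complex.
Import Order.TTheory GRing.Theory Num.Theory.
Import numFieldNormedType.Exports.
Import ComplexField.Normc.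
Local Open Scope classical_set_scope.
Local Open Scope ring_scope.
Local Open Scope complex_scope.

Set Implicit Arguments.
Unset Strict Implicit.
Unset Printing Implicit Defensive.

(* Let |s| = 1 and s^2 = eta with eta = 1 or -1. On the ellipse |w| = 1 the
   real part of s^n F_n is (1 + eta^n r^(2n)) Re ((s w)^n). Hence
   G = 1 + sum_(1 <= n < N) 2 (1 - n/N) s^n F_n / (1 + eta^n r^(2n))
   has the Fejer kernel at s w as real part there, and Re G >= 0 on the whole
   domain by the maximum principle. For small d and much smaller e, the
   polynomial f = 1 - e (G + d) is bounded by 1, and its Bohr sum is
   1 - e (1 + d) + e sum_(1 <= n < N) (1 - n/N) 4 r^n / (1 + eta^n r^(2n)),
   which is at least 1 for large N as soon as the series
   sum_n 4 r^n / (1 + eta^n r^(2n)) exceeds 1. With s = 1 the coefficients are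
   real and r > R_1 suffices; with s = -i, r > R_0 suffices. *)

(** * The equations defining the critical parameters *)

(** Supremum 1, expressed by real inequalities only; for partial sums of nonnegative terms this says
    that the series has sum 1. *)
Definition sup_eq1 {R : realType} (s : nat -> R) :=
  (forall N, s N <= 1) /\ (forall d, 0 < d -> exists N, 1 - d < s N).

Lemma nneseries_eq1 (R : realType) (u : nat -> R) m :
  (forall n, (m <= n)%N -> 0 <= u n) ->
  (\sum_(m <= n <oo) (u n)%:E = 1)%E <->
  sup_eq1 (fun N => \sum_(m <= n < N) u n).
Proof.
move=> u0.
have h : forall n, (m <= n)%N -> true -> (0 <= (u n)%:E)%E.
  by move=> n mn _; rewrite lee_fin u0.
have /cvg_lim -> // := ereal_nondecreasing_cvgn (ereal_nondecreasing_series h).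
set S := (X in ereal_sup X); split => [e|[le1 ge1]].
  split=> [N|d d0].
    rewrite -lee_fin -sumEFin -e; apply: ereal_sup_ubound; by exists N.
  have fS : ereal_sup S \is a fin_num by rewrite e.
  have [_ [N _ <-]] := ub_ereal_sup_adherent d0 fS.
  by rewrite e sumEFin -EFinD lte_fin => ?; exists N.
apply/eqP; rewrite eq_le; apply/andP; split.
  by apply: ge_ereal_sup => _ [N _ <-]; rewrite sumEFin lee_fin.
apply/lee_addgt0Pr => d d0; have [N ltN] := ge1 d d0.
rewrite -leeBlDr// -EFinD (@le_trans _ _ (\sum_(m <= n < N) u n)%:E)//.
  by rewrite lee_fin ltW.
by apply: ereal_sup_ubound; exists N => //; rewrite sumEFin.
Qed.

(** An intermediate value argument for the supremum over N of [s N x], which is continuous because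
    the Lipschitz constant C does not depend on N. The root is the supremum of the points where all
    [s N] are at most 1. *)
Lemma sup_eq1_exists (R : realType) (s : nat -> R -> R) (b C : R) :
  0 <= b -> 0 < C -> (forall N, s N 0 <= 1) -> (exists N, 1 < s N b) ->
  (forall N x y, 0 <= x -> x <= y -> y <= b ->
     s N x <= s N y <= s N x + C * (y - x)) ->
  exists2 x, 0 <= x <= b & sup_eq1 (s^~ x).
Proof.
move=> b0 C0 s0 [M sM] lip.
pose A := [set x : R | 0 <= x <= b /\ forall N, s N x <= 1].
have A0 : A 0 by split=> //; rewrite lexx.
have hA : has_sup A by split; [exists 0|exists b => x [/andP[]]].
have x0 : 0 <= sup A by apply: ub_le_sup => //; case: hA.
have xb : sup A <= b by apply: ge_sup => [|x [/andP[]]]; first by exists 0.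
have s1 N : s N (sup A) <= 1.
  apply/ler_addgt0Pr => e e0.
  have [|x [/andP[x0' xb'] sx] ltx] := @sup_adherent _ A (e / C) _ hA.
    by rewrite divr_gt0.
  have xA : x <= sup A by apply: ub_le_sup; [case: hA|split=> //; rewrite x0'].
  have /andP[_ /le_trans ->//] := lip N x (sup A) x0' xA xb.
  apply: lerD => //; rewrite mulrC -ler_pdivlMr// lerBlDr addrC -lerBlDr; exact: ltW.
exists (sup A); first by rewrite x0.
(* If all [s N] were at most 1 - d at [sup A], they would be at most 1 on the next interval of
   length d / C. Either this interval contains b, against [1 < s M b], or its right end lies in
   A. *)
split=> // d d0; apply: contrapT => /forallNP nd.
have {}nd N : s N (sup A) <= 1 - d by rewrite leNgt; apply/negP/nd.
have [/= le|gt] := leP (sup A + d / C) b; last first.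
  have /andP[_] := lip M (sup A) b x0 xb (lexx _).
  have : C * (b - sup A) <= d.
    by rewrite mulrC -ler_pdivlMr// lerBlDl ltW.
  by have := nd M; lra.
have dC : 0 < d / C by rewrite divr_gt0.
suff /(ub_le_sup (proj2 hA)) : A (sup A + d / C) by lra.
split; first by apply/andP; split => //; lra.
move=> N; have := lip N (sup A) (sup A + d / C) x0; rewrite lerDl (ltW dC).
move=> /(_ erefl le)/andP[_ /le_trans ->//].
rewrite [_ + _ - _]addrC addrA addNr add0r mulrCA divff ?gt_eqF// mulr1.
by have := nd N; lra.
Qed.

(* The series of the [bohr_term 1 x] defines R_1, that of the
   [bohr_term (-1) x] defines R_0. *)
Definition bohr_term {R : realType} (eta x : R) n :=
  4 * x ^+ n / (1 + eta ^+ n * x ^+ (2 * n)).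

Section bohr_series.
Variables (R : realType) (eta : R).
Hypothesis eta1 : `|eta| <= 1.
Implicit Types x y : R.

Let eta_exp n : -1 <= eta ^+ n <= 1.
Proof. by rewrite -ler_norml normrX exprn_ile1. Qed.

Let exp_bounds x n : 0 <= x -> x < 1 -> (0 < n)%N -> 0 <= x ^+ n < 1.
Proof. by move=> x0 x1 n0; rewrite exprn_ge0//= exprn_ilt1// -lt0n. Qed.

Let bohr_termE x n : bohr_term eta x n =
  4 * x ^+ n / (1 + eta ^+ n * (x ^+ n) ^+ 2).
Proof. by rewrite /bohr_term mulnC exprM. Qed.

Lemma bohr_denom_gt0 x n : 0 <= x -> x < 1 -> (0 < n)%N ->
  0 < 1 + eta ^+ n * x ^+ (2 * n).
Proof.
move=> x0 x1 n0; rewrite mulnC exprM.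
have /andP[] := eta_exp n; have /andP[] := exp_bounds x0 x1 n0.
by move: (eta ^+ n) (x ^+ n) => e u *; nra.
Qed.

Lemma bohr_term_ge0 x n : 0 <= x -> x < 1 -> (0 < n)%N -> 0 <= bohr_term eta x n.
Proof.
move=> x0 x1 n0; rewrite divr_ge0 ?mulr_ge0 ?exprn_ge0//.
exact/ltW/bohr_denom_gt0.
Qed.

(** With u = x^n and v = y^n, cross-multiplication leaves 4 (v - u) (1 - eta^n u v), which is
    positive since |eta| <= 1 and u v < 1. *)
Lemma bohr_term_lt x y n : 0 <= x -> x < y -> y < 1 -> (0 < n)%N ->
  bohr_term eta x n < bohr_term eta y n.
Proof.
move=> x0 xy y1 n0; have x1 := lt_trans xy y1.
have y0 := ltW (le_lt_trans x0 xy).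
rewrite ltr_pdivrMr ?bohr_denom_gt0// mulrAC ltr_pdivlMr ?bohr_denom_gt0//.
rewrite mulnC !exprM.
have : x ^+ n < y ^+ n by rewrite ltrXn2r ?nnegrE -?lt0n.
have /andP[] := eta_exp n; have /andP[] := exp_bounds x0 x1 n0.
have /andP[] := exp_bounds y0 y1 n0.
move: (eta ^+ n) (x ^+ n) (y ^+ n) => e u v v0 v1 u0 u1 e0 e1 uv.
rewrite -subr_gt0.
have -> : 4 * v * (1 + e * u ^+ 2) - 4 * u * (1 + e * v ^+ 2) =
  4 * (v - u) * (1 - e * (u * v)) by ring.
have uv0 : 0 <= u * v by rewrite mulr_ge0.
have uv1 : u * v < 1 by nra.
by rewrite !mulr_gt0 ?subr_gt0//; nra.
Qed.

Lemma bohr_term_le x y n : 0 <= x -> x <= y -> y < 1 -> (0 < n)%N ->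
  bohr_term eta x n <= bohr_term eta y n.
Proof.
move=> x0; rewrite le_eqVlt => /predU1P[->//|xy] y1 n0.
exact/ltW/bohr_term_lt.
Qed.

(** For u = x^n and v = y^n in [0, 1/2], the factor 4 (1 - eta^n u v) is at most 5 and each
    denominator is at least 3/4, so the quotient is at most 80/9 <= 9. *)
Lemma bohr_term_lipschitz x y n : 0 <= x -> x <= y -> y <= 2^-1 -> (0 < n)%N ->
  bohr_term eta y n - bohr_term eta x n <= 9 * (y ^+ n - x ^+ n).
Proof.
move=> x0 xy y2 n0; have y0 := le_trans x0 xy; have x2 := le_trans xy y2.
rewrite !bohr_termE.
have : x ^+ n <= y ^+ n by rewrite lerXn2r ?nnegrE -?lt0n.
have : y ^+ n <= 2^-1.
  rewrite (le_trans _ y2)// -[leRHS]expr1 ler_wiXn2l//; lra.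
have : 0 <= x ^+ n by rewrite exprn_ge0.
have /andP[] := eta_exp n.
move: (eta ^+ n) (x ^+ n) (y ^+ n) => e u v e0 e1 u0 v2 uv.
have v0 := le_trans u0 uv; have u2 := le_trans uv v2.
have den w : 0 <= w -> w <= 2^-1 -> 3 / 4 <= 1 + e * w ^+ 2.
  move=> w0 w2; have : w ^+ 2 <= 4^-1 by nra.
  by have := sqr_ge0 w; nra.
have dv := den v v0 v2; have du := den u u0 u2.
have -> : 4 * v / (1 + e * v ^+ 2) - 4 * u / (1 + e * u ^+ 2) =
   4 * (v - u) * (1 - e * (u * v)) / ((1 + e * v ^+ 2) * (1 + e * u ^+ 2)).
  by field; apply/andP; split; rewrite gt_eqF//; lra.
rewrite ler_pdivrMr ?mulr_gt0//; [|lra..].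
have -> : 4 * (v - u) * (1 - e * (u * v)) = (v - u) * (4 * (1 - e * (u * v))) by ring.
rewrite -mulrA [leRHS]mulrCA; apply: ler_wpM2l; first by rewrite subr_ge0.
have uv0 : 0 <= u * v by rewrite mulr_ge0.
have uv1 : u * v <= 4^-1 by nra.
have : 9 / 16 <= (1 + e * v ^+ 2) * (1 + e * u ^+ 2) by nra.
nra.
Qed.

Lemma bohr_sum_lipschitz x y N : 0 <= x -> x <= y -> y <= 2^-1 ->
  \sum_(1 <= n < N) bohr_term eta x n <= \sum_(1 <= n < N) bohr_term eta y n
    <= \sum_(1 <= n < N) bohr_term eta x n + 36 * (y - x).
Proof.
move=> x0 xy y2; apply/andP; split.
  rewrite !big_nat; apply: ler_sum => n /andP[n0 _].
  by apply: bohr_term_le => //; lra.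
rewrite addrC -lerBlDr -sumrB.
pose G z M : R := \sum_(1 <= n < M.+1) z ^+ n.
have GS z M : G z M.+1 = z * (1 + G z M).
  rewrite /G big_nat_recl//= expr1 mulrDr mulr1 mulr_sumr; congr (_ + _).
  by apply: eq_bigr => i _; rewrite exprS.
have G0 z : G z 0 = 0 by rewrite /G big_geq.
(* The geometric sums have slope at most 1 / ((1 - x) (1 - y)) <= 4 on [0, 1/2]; together with the
   constant 9 of the single terms this gives 36. *)
have Gb M : 0 <= G x M /\ G y M <= 1 /\ G y M - G x M <= 4 * (y - x).
  elim: M => [|M [h1 [h2 h3]]]; first by rewrite !G0; do !split; lra.
  rewrite !GS; do !split; nra.
apply: (@le_trans _ _ (\sum_(1 <= n < N) 9 * (y ^+ n - x ^+ n))).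
  rewrite !big_nat; apply: ler_sum => n /andP[n0 _].
  exact: bohr_term_lipschitz.
rewrite -mulr_sumr sumrB; case: N => [|N]; first by rewrite !big_geq//; lra.
by have [_ [_]] := Gb N; rewrite /G; lra.
Qed.

Lemma bohr_root_exists : exists2 x, 0 < x < 1 &
  sup_eq1 (fun N => \sum_(1 <= n < N) bohr_term eta x n).
Proof.
have bt0 N : \sum_(1 <= n < N) bohr_term eta 0 n = 0.
  rewrite big_nat big1// => n /andP[n0 _].
  by rewrite /bohr_term expr0n gtn_eqF//= mulr0 mul0r.
have [||||N x y|x /andP[x0 x2] h] := @sup_eq1_exists _
    (fun N x => \sum_(1 <= n < N) bohr_term eta x n) 2^-1 36.
- by lra.
- by lra.
- by move=> N; rewrite bt0.
(* At 1/2 the first term alone is 2 / (1 + eta / 4) >= 8/5, so the root can be sought in [0, 1/2],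
   away from 1. *)
- exists 2%N; rewrite big_nat1 /bohr_term !expr1 muln1.
  have /andP[] := eta_exp 1; rewrite expr1 => e0 e1.
  have -> : (2^-1 : R) ^+ 2 = 4^-1 by field.
  by rewrite ltr_pdivlMr; lra.
- exact: bohr_sum_lipschitz.
exists x => //; rewrite lt_neqAle x0 andbT; apply/andP; split; last by lra.
apply/eqP => x0'; move: h; rewrite -x0' => -[_ /(_ 1 ltr01)[N]].
by rewrite bt0 subrr ltxx.
Qed.

(** Passing from x to y, the term n = 1 gains a fixed positive amount and no other term decreases. A
    partial sum at x that misses 1 by less than this gain therefore exceeds 1 at y. *)
Lemma bohr_sum_gt1 x y : 0 < x -> x < y -> y < 1 ->
  sup_eq1 (fun N => \sum_(1 <= n < N) bohr_term eta x n) ->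
  exists N, 1 < \sum_(1 <= n < N) bohr_term eta y n.
Proof.
move=> x0 xy y1 [_ /(_ (bohr_term eta y 1 - bohr_term eta x 1))[|N]].
  by rewrite subr_gt0 bohr_term_lt// ltW.
have hle M M' : (M <= M')%N ->
    \sum_(1 <= n < M) bohr_term eta x n <= \sum_(1 <= n < M') bohr_term eta x n.
  move=> MM'; case: M MM' => [|M] MM'.
    rewrite big_geq// big_nat sumr_ge0// => n /andP[n0 _].
    by rewrite bohr_term_ge0 ?ltW// (lt_trans xy).
  rewrite [leRHS](big_cat_nat _ MM')//= lerDl big_nat sumr_ge0// => n /andP[n0 _].
  by rewrite bohr_term_ge0 ?ltW ?(leq_trans _ n0)// (lt_trans xy).
(* The bound [N.+2] ensures that the term n = 1 is present even when N = 0. *)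
move=> h; exists N.+2.
have := hle N N.+2; rewrite leqW ?leqnSn// => /(_ erefl).
have : \sum_(2 <= n < N.+2) bohr_term eta x n <= \sum_(2 <= n < N.+2) bohr_term eta y n.
  rewrite !big_nat; apply: ler_sum => n /andP[n0 _].
  by apply: bohr_term_le; rewrite ?ltW// (leq_trans _ n0).
move=> hy hx; rewrite big_ltn//; rewrite [leRHS]big_ltn// in hx.
lra.
Qed.
End bohr_series.

(** * Maximum principle for the real part of a polynomial *)

(* [Re] alone would denote [Num.Re], which takes its values in [R[i]]. *)
Local Notation Re := complex.Re.

Section complex_polynomials.
Variable R : realType.
Implicit Types (p q : {poly R[i]}) (z w x : R[i]) (A : set R[i]).

Lemma derivable_horner_complex p z : derivable (horner p) z 1.
Proof.
elim/poly_ind: p => [|p c ih].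
  rewrite (_ : horner 0 = cst 0); first exact: derivable_cst.
  by apply/funext => w; rewrite horner0.
rewrite (_ : horner _ = (horner p * id) + cst c); last first.
  by apply/funext => w; rewrite !hornerE.
apply: derivableD; last exact: derivable_cst.
by apply: derivableM; [exact: ih|exact: derivable_id].
Qed.

Lemma continuous_horner_complex p : continuous (horner p).
Proof.
move=> z; elim/poly_ind: p => [|p c ih].
  rewrite (_ : horner 0 = cst 0); first exact: cst_continuous.
  by apply/funext => w; rewrite horner0.
rewrite (_ : horner _ = (fun w => p.[w] * w + c)); last first.
  by apply/funext => w; rewrite !hornerE.
apply: (@cvgD _ _ _ (nbhs z)); last exact: cvg_cst.
by apply: (@cvgM _ _ (nbhs z)); [exact: ih|exact: cvg_id].
Qed.

Lemma ReD z w : Re (z + w) = Re z + Re w.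
Proof. by case: z w => ? ? [? ?]. Qed.

Lemma ReN z : Re (- z) = - Re z.
Proof. by case: z. Qed.

Lemma ReZ (a : R) z : Re (a%:C * z) = a * Re z.
Proof. by case: z => x y /=; rewrite mul0r subr0. Qed.

Lemma normc_i : normc 'i = 1 :> R.
Proof. by rewrite /normc expr0n expr1n add0r sqrtr1. Qed.

Lemma normc_Re z : `|Re z| <= normc z.
Proof. by rewrite -lecR -normC_normc; exact: normc_ge_Re. Qed.

Lemma nbhs_complexP z A :
  nbhs z A <-> exists2 d : R, 0 < d & forall w, normc (w - z) < d -> A w.
Proof.
split=> [/nbhs_ballP[[x y]/= ]|[d d0 dA]].
  rewrite ltcE /= => /andP[/eqP -> x0] xA; exists x => // w wz; apply: xA.
  by rewrite -ball_normE /= distrC normC_normc ltcR.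
apply/nbhs_ballP; exists d%:C => /=; first by rewrite ltcR.
by move=> w; rewrite -ball_normE /= distrC normC_normc ltcR; exact: dA.
Qed.

Lemma continuous_Re : continuous (@Re R).
Proof.
move=> z; apply/(@cvgrPdist_lt _ _ _ (nbhs z)) => e e0.
apply/nbhs_complexP; exists e => // w; apply: le_lt_trans.
by rewrite distrC -ReN -ReD normc_Re.
Qed.

Lemma continuous_Complex : continuous (fun u : R * R => u.1 +i* u.2).
Proof.
move=> [a b] /= B /nbhs_complexP[d d0 dB].
apply/nbhs_ballP; exists (d / 2) => /=; first by rewrite divr_gt0.
move=> [x y] [/=]; rewrite -!ball_normE /= => xa yb; apply: dB.
have -> : x +i* y - (a +i* b) = (x - a)%:C + 'i * (y - b)%:C by simpc.
rewrite (le_lt_trans (le_normcD _ _))// normcM !normcR.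
by rewrite normc_i mul1r distrC (distrC y) (splitr d) ltrD.
Qed.

Lemma complex_compact A B :
  closed A -> (forall z, A z -> normc z <= B) -> compact A.
Proof.
move=> clA bA; pose S : set (R * R) := `[-B, B] `*` `[-B, B].
apply: (@subclosed_compact _ _ ((fun u : R * R => u.1 +i* u.2) @` S)) => //.
  apply: continuous_compact; first exact/continuous_subspaceT/continuous_Complex.
  by apply: compact_setX; exact: segment_compact.
move=> [x y] /bA h; exists (x, y) => //.
have := sqr_normcE x y; have := normc_ge0 (x +i* y).
by split; rewrite /= in_itv /=; apply/andP; split; nra.
Qed.

Lemma horner_bounded q (B : R) :
  exists M : R, forall x, normc x <= B -> normc q.[x] <= M.
Proof.
elim/poly_ind: q => [|q c [M hM]].
  by exists 0 => x _; rewrite horner0 normc0.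
exists (`|M| * `|B| + normc c) => x xB; rewrite !hornerE.
rewrite (le_trans (le_normcD _ _))// lerD2r normcM.
by rewrite ler_pM ?normc_ge0// (le_trans _ (ler_norm _))// hM.
Qed.

(** Taylor expansion with a polynomial remainder. The terms in c and d cancel when summed over x =
    h, -h, i h, -i h. *)
Lemma horner_cubic p z : exists c d q, forall x,
  p.[z + x] = p.[z] + c * x + d * x ^+ 2 + q.[x] * x ^+ 3.
Proof.
have split_horner q : exists q', forall x, q.[x] = q.[0] + q'.[x] * x.
  elim/poly_ind: q => [|q c _]; first by exists 0 => x; rewrite !horner0 mul0r addr0.
  by exists q => x; rewrite !hornerE addrC.
have [q1 h1] := split_horner (p \Po ('X + z%:P)).
have [q2 h2] := split_horner q1; have [q3 h3] := split_horner q2.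
exists q1.[0], q2.[0], q3 => x; have := h1 x.
rewrite !horner_comp !hornerD !hornerX !hornerC add0r addrC => ->.
by rewrite h2 h3; ring.
Qed.

(** The minimum principle for the harmonic function Re p; the points of A outside its interior serve
    as the boundary. *)
Lemma Re_horner_ge0 p A : compact A ->
  (forall z, A z -> ~ A° z -> 0 <= Re p.[z]) ->
  forall z, A z -> 0 <= Re p.[z].
Proof.
move=> cA bA z1 Az1; rewrite leNgt; apply/negP => pz1.
have csub (f : R[i] -> R) : continuous f -> {within A, continuous f}.
  by move=> cf; exact: continuous_subspaceT.
have A0 : A !=set0 by exists z1.
have csqr : continuous (fun z : R[i] => normc z ^+ 2).
  move=> z; apply: (@continuous_comp _ _ _ (@normc R) (fun t => t ^+ 2)).
    exact: normc_continuous.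
  exact: exprn_continuous.
have [b _ hb] := compact_EVT_max A0 cA (csub _ csqr).
(* With this e, a minimum c of u outside the interior is impossible: there u c >= - e |b|^2, whereas
   u z1 <= Re p(z1) = - e (|b|^2 + 1). *)
pose e := - Re p.[z1] / (normc b ^+ 2 + 1).
have b1 : 0 < normc b ^+ 2 + 1 by rewrite ltr_wpDl ?sqr_ge0.
have e0 : 0 < e by rewrite divr_gt0 ?oppr_gt0.
(* [u] is strictly superharmonic, so its minimum on [A] is not interior: the
   mean over the four points [c + i^k h] of a cubic polynomial is exact. *)
pose u z : R := Re p.[z] - e * normc z ^+ 2.
have cu : continuous u.
  move=> z; apply: (@cvgB _ _ _ (nbhs z)).
    apply: (@continuous_comp _ _ _ (horner p) (@Re R)).
      exact: continuous_horner_complex.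
    exact: continuous_Re.
  by apply: (@cvgM _ _ (nbhs z)); [exact: cvg_cst|exact: csqr].
have [c /set_mem Ac hc] := compact_EVT_min A0 cA (csub _ cu).
have [|nI] := pselect (A° c); last first.
  have pc := bA _ Ac nI.
  have := hc z1 (mem_set Az1); rewrite /u; have := hb c (mem_set Ac).
  have : e * (normc b ^+ 2 + 1) = - Re p.[z1] by rewrite mulfVK ?gt_eqF.
  have := sqr_ge0 (normc z1); nra.
move=> /nbhs_complexP[d d0 dA].
have [k1 [k2 [q hq]]] := horner_cubic p c.
have [M hM] := horner_bounded q 1.
have M0 : 0 <= M by rewrite (le_trans (normc_ge0 q.[0]))// hM// normc0.
(* The three bounds keep h in the disc where |q| <= M, keep the four points in A, and give h M <
   e. *)
pose h := Num.min 1 (Num.min (d / 2) (e / (M + 1) / 2)).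
have h0 : 0 < h by rewrite !lt_min ltr01 !divr_gt0//; lra.
have h1 : h <= 1 by rewrite ge_min lexx.
have hd : h < d.
  have : h <= d / 2 by rewrite !ge_min lexx orbT.
  lra.
have he : h * M < e.
  have : h <= e / (M + 1) / 2 by rewrite !ge_min lexx !orbT.
  rewrite -mulrA -invfM ler_pdivlMr; last by lra.
  by nra.
have nh : normc h%:C = h by rewrite normcR gtr0_norm.
have key v : normc v = 1 -> u c <= u (c + v * h%:C).
  move=> v1; apply/hc/mem_set/dA.
  by rewrite addrAC subrr add0r normcM v1 mul1r nh.
have := key 1 (normc1 _); have := key (-1); have := key 'i normc_i; have := key (- 'i).
rewrite !normcN normc1 normc_i => /(_ erefl) k3 k4 /(_ erefl) k5 k6.
pose s := q.[h%:C] - q.[- h%:C] - 'i * q.['i * h%:C] + 'i * q.[- 'i * h%:C].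
have sump : Re p.[c + 1 * h%:C] + Re p.[c + -1 * h%:C] + Re p.[c + 'i * h%:C]
    + Re p.[c + - 'i * h%:C] = 4 * Re p.[c] + h ^+ 3 * Re s.
  rewrite -!ReD -!ReZ -ReD !hq rmorphXn rmorph_nat /s.
  have i2 : ('i * h%:C) ^+ 2 = - h%:C ^+ 2 by rewrite exprMn sqr_i mulN1r.
  have i3 : ('i * h%:C) ^+ 3 = - 'i * h%:C ^+ 3.
    by rewrite exprMn exprS sqr_i mulrN1.
  rewrite !mulNr !sqrrN [(- ('i * _)) ^+ 3]exprS sqrrN i2 i3 mul1r.
  by congr Re; ring.
have sumn : normc (c + 1 * h%:C) ^+ 2 + normc (c + -1 * h%:C) ^+ 2
   + normc (c + 'i * h%:C) ^+ 2 + normc (c + - 'i * h%:C) ^+ 2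
   = 4 * normc c ^+ 2 + 4 * h ^+ 2.
  case: (c) => a b'; simpc; rewrite !sqr_normcE; ring.
have sM : Re s <= 4 * M.
  rewrite (le_trans (ler_norm _))// (le_trans (normc_Re _))// /s.
  have n4 (v1 v2 v3 v4 : R[i]) :
      normc (v1 + v2 + v3 + v4) <= normc v1 + normc v2 + normc v3 + normc v4.
    have := le_normcD (v1 + v2 + v3) v4; have := le_normcD (v1 + v2) v3.
    by have := le_normcD v1 v2; lra.
  apply: le_trans (n4 _ _ _ _) _; rewrite !(normcN, normcM) normc_i !mul1r.
  have := hM h%:C; have := hM (- h%:C); have := hM ('i * h%:C).
  have := hM (- 'i * h%:C).
  rewrite !(normcN, normcM) normc_i nh !mul1r => /(_ h1) + /(_ h1) + /(_ h1) + /(_ h1).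
  lra.
(* Sum of the four inequalities u c <= u (c + v h). Since Re s <= 4 M, it contradicts h M < e. *)
have : 4 * (e * h ^+ 2) <= h ^+ 3 * Re s.
  move: k3 k4 k5 k6; have := congr1 ( *%R e) sumn; rewrite /u !mulrDr; lra.
apply/negP; rewrite -ltNge.
have -> : h ^+ 3 * Re s = h ^+ 2 * (h * Re s) by rewrite mulrA -exprSr.
rewrite (_ : 4 * _ = h ^+ 2 * (4 * e)); last by ring.
rewrite ltr_pM2l ?exprn_gt0//.
by have := ler_wpM2l (ltW h0) sM; lra.
Qed.

End complex_polynomials.

(** * Fejer means *)

Section fejer.
Variable R : realType.
Implicit Types (z w : R[i]).

Lemma Re_sum (I : Type) (s : seq I) (P : pred I) (F : I -> R[i]) :
  Re (\sum_(i <- s | P i) F i) = \sum_(i <- s | P i) Re (F i).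
Proof. by apply: (big_morph (@Re R)) => //; exact: ReD. Qed.

Lemma normc_sqrD z w :
  normc (z + w) ^+ 2 = normc z ^+ 2 + 2 * Re (z * w^*) + normc w ^+ 2.
Proof. by case: z w => a b [c d]; simpc; rewrite !sqr_normcE /=; ring. Qed.

Lemma normcX z n : normc (z ^+ n) = normc z ^+ n.
Proof.
by elim: n => [|n ih]; rewrite ?expr0 ?normc1// !exprS normcM ih.
Qed.

Lemma mulcJ_unit w : normc w = 1 -> w * w^* = 1.
Proof.
move=> w1; rewrite -sqr_normc normC_normc w1.
by rewrite expr1n.
Qed.

Lemma invc_unit w : normc w = 1 -> w^-1 = w^*.
Proof.
move=> w1; apply: (can_inj invrK); rewrite invrK; apply: esym.
by rewrite -[LHS]mul1r -(mulcJ_unit w1) mulfK// conjc_eq0; apply/eqP => w0;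
  move: w1; rewrite w0 normc0 => /eqP; rewrite eq_sym oner_eq0.
Qed.

Lemma Re_mulJ_exp w m n : normc w = 1 -> (m <= n)%N ->
  Re (w ^+ m * (w ^+ n)^*) = Re (w ^+ (n - m)).
Proof.
move=> w1 mn; rewrite -{1}(subnKC mn) exprD rmorphM mulrA mulcJ_unit.
  by rewrite mul1r; case: (w ^+ _).
by rewrite normcX w1 expr1n.
Qed.

(** By induction: adding w^N to the geometric sum increases its squared modulus by 1 and the cross
    terms 2 Re (w^n conj(w^N)) = 2 Re w^(N - n), n < N. *)
Lemma fejer_kernelE w N : normc w = 1 ->
  2 * (\sum_(n < N) (N%:R - n%:R) * Re (w ^+ n)) - N%:R =
  normc (\sum_(n < N) w ^+ n) ^+ 2.
Proof.
move=> w1; elim: N => [|N ih].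
  by rewrite !big_ord0 mulr0 subr0 normc0 expr0n.
rewrite [in RHS]big_ord_recr/= normc_sqrD -ih normcX w1 expr1n mulr_suml Re_sum.
have -> : \sum_(i < N) Re (w ^+ i * (w ^+ N)^*) = \sum_(i < N) Re (w ^+ i.+1).
  rewrite (reindex_inj rev_ord_inj); apply: eq_bigr => i _ /=.
  by rewrite Re_mulJ_exp ?leq_subr// subKn.
have -> : \sum_(i < N) Re (w ^+ i.+1) = \sum_(i < N.+1) Re (w ^+ i) - 1.
  by rewrite [in RHS]big_ord_recl/= addrAC subrr add0r.
have -> : \sum_(n < N.+1) (N.+1%:R - n%:R) * Re (w ^+ n) =
    \sum_(n < N) (N%:R - n%:R) * Re (w ^+ n) + \sum_(n < N.+1) Re (w ^+ n).
  transitivity (\sum_(n < N.+1) (N%:R - n%:R) * Re (w ^+ n)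
    + \sum_(n < N.+1) Re (w ^+ n)).
    by rewrite -big_split/=; apply: eq_bigr => i _; rewrite -natr1; ring.
  by rewrite big_ord_recr/= subrr mul0r addr0.
by rewrite -natr1; ring.
Qed.

(** This is [fejer_kernelE] for N + 1 divided by N + 1; the term n = 0 and the subtracted N + 1
    combine to the constant 1. *)
Lemma fejer_kernel_ge0 w N : normc w = 1 ->
  0 <= 1 + \sum_(1 <= n < N.+1) 2 * (1 - n%:R / N.+1%:R) * Re (w ^+ n).
Proof.
move=> w1; have := sqr_ge0 (normc (\sum_(n < N.+1) w ^+ n)).
rewrite -fejer_kernelE// -(big_mkord xpredT (fun n => (N.+1%:R - n%:R) * Re (w ^+ n))).
rewrite big_ltn//= subr0 mulr1 => h.
rewrite -(pmulr_rge0 _ (ltr0Sn R N)) mulrDr mulr1 mulr_sumr.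
rewrite (eq_bigr (fun n => 2 * ((N.+1%:R - n%:R) * Re (w ^+ n)))) => [|n _].
  by rewrite -mulr_sumr; lra.
by field; rewrite addrC natr1 pnatr_eq0.
Qed.

End fejer.

(** For n < M the weights are at least 1 - M / (N + 1), which tends to 1 as N grows; the terms from
    M on only help. *)
Lemma cesaro_weights_gt (R : realType) (u : nat -> R) (c : R) :
  (forall n, (0 < n)%N -> 0 <= u n) ->
  (exists M, c < \sum_(1 <= n < M) u n) ->
  exists N, c < \sum_(1 <= n < N.+1) (1 - n%:R / N.+1%:R) * u n.
Proof.
move=> u0 [M]; set S := \sum_(1 <= n < M) u n => cS.
have S0 : 0 <= S by rewrite /S big_nat sumr_ge0// => n /andP[n0 _]; exact: u0.
(* Chosen so that M <= N + 1 and (1 - M / (N + 1)) S > c. *)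
pose N := (M + Num.truncn (M%:R * S / (S - c)))%N; exists N.
have MN : (M <= N.+1)%N by rewrite leqW// leq_addr.
have N0 : 0 < N.+1%:R :> R by [].
have NS : M%:R * S < N.+1%:R * (S - c).
  rewrite -ltr_pdivrMr ?subr_gt0// (lt_le_trans (truncnS_gt _))//.
  by rewrite ler_nat ltnS leq_addl.
apply: (@lt_le_trans _ _ ((1 - M%:R / N.+1%:R) * S)).
  have : M%:R * S / N.+1%:R < S - c by rewrite ltr_pdivrMr// [ltRHS]mulrC.
  by rewrite mulrAC mulrBl mul1r => ?; rewrite ltrBrDr -ltrBrDl.
have h n : (n < N.+1)%N -> 0 <= 1 - n%:R / N.+1%:R :> R.
  by move=> nN; rewrite subr_ge0 ler_pdivrMr// mul1r ler_nat ltnW.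
apply: (@le_trans _ _ (\sum_(1 <= n < M) (1 - n%:R / N.+1%:R) * u n)).
  rewrite mulr_sumr !big_nat; apply: ler_sum => n /andP[n0 nM].
  rewrite ler_wpM2r ?u0// lerB// ler_pM2r ?invr_gt0// ler_nat; exact: ltnW.
have [M0|M0] := posnP M.
  rewrite M0 big_geq// big_nat sumr_ge0// => n /andP[n0 nN].
  by rewrite mulr_ge0 ?h ?u0.
rewrite [leRHS](big_cat_nat M0 MN)//= lerDl big_nat sumr_ge0// => n /andP[Mn nN].
by rewrite mulr_ge0 ?h ?u0// (leq_trans M0 Mn).
Qed.

(** * Polynomials violating the Bohr inequality *)

Section bohr_counterexample.
Variables (R : realType) (r : R).
Hypothesis r01 : 0 < r < 1.
Let r0 : 0 < r. Proof. by case/andP: r01. Qed.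
Let r1 : r < 1. Proof. by case/andP: r01. Qed.

Lemma closed_ellipse_bounded z :
  normc (z - 1) + normc (z + 1) <= r^-1 + r -> normc z <= r^-1 + r.
Proof.
have := le_normcD (z - 1) (z + 1).
have -> : z - 1 + (z + 1) = 2%:C * z by rewrite rmorph_nat; ring.
by rewrite normcM normcR ger0_norm//; have := normc_ge0 z; lra.
Qed.

(** The minimum principle on the closed elliptic region. Its points outside the interior lie on the
    ellipse, because the domain is open. *)
Lemma ellipse_Re_horner_ge0 (p : {poly R[i]}) :
  (forall z, ellipse r z -> 0 <= Re p.[z]) ->
  forall z, ellipse_domain r z -> 0 <= Re p.[z].
Proof.
move=> hp z Ez.
pose A := [set z : R[i] | normc (z - 1) + normc (z + 1) <= r^-1 + r].
apply: (@Re_horner_ge0 _ p A) => [|y Ay nAy|]; last exact: ltW.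
  apply: complex_compact closed_ellipse_bounded.
  apply: (@preimage_closed _ _ (fun z : R[i] => normc (z - 1) + normc (z + 1))
    [set x | x <= r^-1 + r]).
    by move=> y _; exact: focal_sum_continuous.
  exact: closed_le.
apply: hp; rewrite ellipseE//=; apply/eqP; rewrite eq_le Ay leNgt /=.
apply/negP => Ey; apply: nAy; apply: (filterS (P := ellipse_domain r)).
  by move=> x /ltW.
by apply: open_nbhs_nbhs; split=> //; exact: open_ellipse_domain.
Qed.

Lemma faber_sup_ge n z : K z ->
  normc (faber r n).[z] <= sup [set normc (faber r n).[z] | z in @K R].
Proof.
move=> Kz; apply: ub_le_sup; last by exists z.
(* [sup] is meaningful only for a bounded set; K lies in the closed unit disc, where the polynomial
   is bounded. *)
have [M hM] := horner_bounded (faber r n) 1; exists M => _ [_ [x + <-] <-].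
by rewrite /= in_itv /= -ler_norml => x1; apply: hM; rewrite normcR.
Qed.

(** The value at the point 1, reached for w = r, is r^n + r^(2n) r^(-n) = 2 r^n. *)
Lemma faber_sup_lower n : (0 < n)%N ->
  2 * r ^+ n <= sup [set normc (faber r n).[z] | z in @K R].
Proof.
move=> n0; have K1 : K (joukowski r r%:C).
  by apply: joukowski_K; rewrite ?normcR ?gtr0_norm.
apply: le_trans (faber_sup_ge n K1).
rewrite faberE ?realC_neq0// -!rmorphXn -fmorphV -rmorphM -rmorphD.
rewrite normcR mulnC exprM expr2 mulfK ?gt_eqF ?exprn_gt0//.
by rewrite ger0_norm ?addr_ge0 ?exprn_ge0 ?(ltW r0)// mulr_natl mulr2n.
Qed.

Lemma faber_expansion_finite (a : nat -> R[i]) N :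
  (forall n, (N <= n)%N -> a n = 0) ->
  faber_expansion r a (fun z => \sum_(0 <= n < N) a n * (faber r n).[z]).
Proof.
move=> a0 A cA AE; apply: (@cvg_near_cst nat {uniform` A -> R[i]}).
exists N => // M /= NM.
apply/funext => z; rewrite (big_cat_nat _ NM)//= [X in _ + X]big_nat [X in _ + X]big1 ?addr0//.
by move=> n /andP[Nn _]; rewrite a0// mul0r.
Qed.

Variables (eta : R) (s : R[i]).
Hypotheses (eta2 : eta ^+ 2 = 1) (s1 : normc s = 1) (s2 : s ^+ 2 = eta%:C).

(** From |s| = 1 and s^2 = eta follows s^n = eta^n conj(s^n). Hence s^n w^(-n) is eta^n times the
    conjugate of (s w)^n and has, up to this sign, the same real part. *)
Lemma Re_faber_ellipse n w : (0 < n)%N -> normc w = 1 ->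
  Re (s ^+ n * (faber r n).[joukowski r w]) =
  (1 + eta ^+ n * r ^+ (2 * n)) * Re ((s * w) ^+ n).
Proof.
move=> n0 w1; have w0 : w != 0.
  by apply/eqP => w0; move: w1; rewrite w0 normc0 => /eqP; rewrite eq_sym oner_eq0.
have sE : s ^+ n = (eta ^+ n)%:C * (s ^+ n)^*.
  rewrite rmorphXn /= -s2 -exprM mul2n -addnn exprD -mulrA mulcJ_unit ?mulr1//.
  by rewrite normcX s1 expr1n.
have wE : w ^- n = (w ^+ n)^* by rewrite invc_unit// normcX w1 expr1n.
rewrite faberE// mulrDr -exprMn [X in _ + X]mulrCA ReD ReZ {1}sE wE.
rewrite -mulrA -rmorphM -exprMn ReZ mulrDl mul1r; congr (_ + _).
by rewrite mulrA [r ^+ _ * _]mulrC; case: ((s * w) ^+ n).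
Qed.

(** The condition on F concerns coefficients that are real multiples of s^n, so that both classes of
    functions are covered. *)
Lemma not_bohr_phenomenon (F : set (R[i] -> R[i])) :
  (forall f a, holomorphic_on (ellipse_domain r) f -> faber_expansion r a f ->
     (forall n, exists c : R, a n = c%:C * s ^+ n) -> F f) ->
  (exists M, 1 < \sum_(1 <= n < M) bohr_term eta r n) ->
  ~ bohr_phenomenon r F.
Proof.
move=> hF hM.
have eta1 : `|eta| <= 1.
  by have /eqP := eta2; rewrite sqrf_eq1 => /orP[]/eqP->; rewrite ?normrN normr1.
have [n n0|N hN] := cesaro_weights_gt _ hM; first exact: bohr_term_ge0 (ltW r0) _ _.
have den n : (0 < n)%N -> 0 < 1 + eta ^+ n * r ^+ (2 * n).
  by move=> n0; apply: bohr_denom_gt0 => //; exact: ltW.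
(* The coefficients of G without their factor s^n; they vanish beyond N, so that f has a finite
   Faber expansion. *)
pose c n : R := if n == 0%N then 1 else
  if (n < N.+1)%N then 2 * (1 - n%:R / N.+1%:R) / (1 + eta ^+ n * r ^+ (2 * n)) else 0.
pose G := \sum_(0 <= n < N.+1) ((c n)%:C * s ^+ n) *: faber r n.
have ReG z : ellipse_domain r z -> 0 <= Re G.[z].
  apply: ellipse_Re_horner_ge0 => {}z; case=> w /= w1 <-.
  rewrite horner_sum Re_sum big_ltn// expr0 mulr1 hornerZ hornerC mulr1.
  have sw1 : normc (s * w) = 1 by rewrite normcM s1 w1 mulr1.
  have := fejer_kernel_ge0 N sw1; congr (_ <= _ + _).
  apply: eq_big_nat => n /andP[n0 nN].
  rewrite hornerZ -[in RHS]mulrA ReZ Re_faber_ellipse// /c gtn_eqF// nN.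
  by rewrite [RHS]mulrA mulfVK// gt_eqF ?den.
have [M hG] := horner_bounded G (r^-1 + r).
(* d is the excess of the weighted Bohr series over 1, and also the shift making Re (G + d) strictly
   positive. *)
set S := (X in 1 < X) in hN; pose d := S - 1.
have d0 : 0 < d by rewrite subr_gt0.
(* The first bound gives e |G + d|^2 < 2 Re (G + d), hence |f| < 1; the second keeps the constant
   coefficient 1 - e (1 + d) nonnegative. *)
pose e := Num.min (d / ((`|M| + d) ^+ 2 + 1)) (1 + d)^-1.
have D0 : 0 < (`|M| + d) ^+ 2 + 1 by rewrite ltr_wpDl ?sqr_ge0.
have e0 : 0 < e by rewrite lt_min divr_gt0 ?invr_gt0//; lra.
have eM : e * ((`|M| + d) ^+ 2 + 1) <= d.
  by rewrite -ler_pdivlMr// ge_min lexx.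
have ed : e * (1 + d) <= 1.
  by rewrite -ler_pdivlMr ?div1r ?ge_min ?lexx ?orbT//; lra.
pose b n : R := if n == 0%N then 1 - e * (1 + d) else - e * c n.
pose a n : R[i] := (b n)%:C * s ^+ n.
pose f z := \sum_(0 <= n < N.+1) a n * (faber r n).[z].
have fE z : f z = 1 - e%:C * (G.[z] + d%:C).
  have tailE : \sum_(1 <= n < N.+1) a n * (faber r n).[z] =
      - e%:C * \sum_(1 <= n < N.+1) (((c n)%:C * s ^+ n) *: faber r n).[z].
    rewrite mulr_sumr; apply: eq_big_nat => n /andP[n0 nN].
    by rewrite /a /b gtn_eqF// hornerZ rmorphM rmorphN !mulrA.
  rewrite /f /G horner_sum big_ltn// [in RHS]big_ltn// tailE.
  rewrite /a /b /c /= expr0 hornerZ hornerC rmorphB rmorphM rmorphD !rmorph1.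
  ring.
have holo : holomorphic_on (ellipse_domain r) f.
  move=> z _; rewrite (_ : f = horner (1 - e%:C *: (G + d%:C%:P))).
    exact: derivable_horner_complex.
  by apply/funext => y; rewrite fE !hornerE.
have fexp : faber_expansion r a f.
  apply: faber_expansion_finite => n Nn.
  by rewrite /a /b /c gtn_eqF ?(leq_trans _ Nn)// ltnNge Nn /= mulr0 mul0r.
have flt1 z : ellipse_domain r z -> normc (f z) < 1.
  move=> Ez; rewrite fE.
  have zM : normc G.[z] <= `|M|.
    by rewrite (le_trans _ (ler_norm _))// hG// closed_ellipse_bounded// ltW.
  rewrite -(@ltr_pXn2r _ 2) ?nnegrE ?normc_ge0// expr1n normc_sqrD normc1 expr1n.
  set x := G.[z] + d%:C.
  have Rex : d <= Re x by rewrite /x ReD /= lerDr ReG.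
  have nx : normc x <= `|M| + d.
    by rewrite (le_trans (le_normcD _ _))// normcR (gtr0_norm d0) lerD2r.
  rewrite normcN normcM normcR (gtr0_norm e0) mul1r.
  have -> : Re (- (e%:C * x))^* = - (e * Re x).
    by rewrite -ReZ -ReN; case: (- _).
  have nx2 : normc x ^+ 2 <= (`|M| + d) ^+ 2.
    by rewrite lerXn2r ?nnegrE ?normc_ge0// (le_trans (normc_ge0 x)).
  have : e * (normc x ^+ 2) < 2 * Re x.
    by have := ler_wpM2l (ltW e0) nx2; lra.
  rewrite -(ltr_pM2l e0) exprMn; lra.
move=> /(_ f a (hF f a holo fexp (fun n => ex_intro _ (b n) erefl)) fexp flt1).
apply/negP; rewrite -leNgt.
have K1 : K (1 : R[i]).
  by exists 1 => //=; rewrite in_itv/= lexx andbT; lra.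
have sup0 n : 0 <= sup [set normc (faber r n).[z] | z in @K R].
  by apply: le_trans (faber_sup_ge n K1); exact: normc_ge0.
apply: le_trans (nneseries_lim_ge N.+1 _); last first.
  by move=> n _ _; rewrite lee_fin mulr_ge0// normc_ge0.
rewrite sumEFin lee_fin big_ltn//.
(* Since S = 1 + d, this lower bound of the Bohr sum equals 1, which already violates the strict
   inequality. *)
apply: (@le_trans _ _ ((1 - e * (1 + d)) + e * S)).
  rewrite /d; lra.
apply: lerD.
  rewrite /a expr0 mulr1 normcR /b eqxx ger0_norm ?subr_ge0//.
  rewrite ler_peMr ?subr_ge0// (le_trans _ (faber_sup_ge 0 K1))//.
  by rewrite /= hornerC normc1.
rewrite mulr_sumr !big_nat; apply: ler_sum => n /andP[n0 nN].
have cn0 : 0 <= c n.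
  rewrite /c gtn_eqF// nN divr_ge0 ?(ltW (den _ _))// mulr_ge0// subr_ge0.
  by rewrite ler_pdivrMr// mul1r ler_nat ltnW.
have -> : normc (a n) = e * c n.
  rewrite /a /b gtn_eqF// normcM normcX s1 expr1n mulr1 normcR mulNr normrN.
  by rewrite ger0_norm// mulr_ge0// ltW.
apply: le_trans (ler_wpM2l _ (faber_sup_lower n0)); last by rewrite mulr_ge0// ltW.
rewrite /c gtn_eqF// nN /bohr_term le_eqVlt; apply/orP; left; apply/eqP.
by field; rewrite gt_eqF ?den// addrC natr1 pnatr_eq0.
Qed.
End bohr_counterexample.

(** * Uniqueness of the critical parameters and conclusion *)

Section bohr_equation.
Variables (R : realType) (eta : R).
Hypothesis eta1 : `|eta| <= 1.

(** P stands for the equation in the extended reals. Beyond a root some partial sum exceeds 1, which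
    excludes a second root and gives the last claim. *)
Lemma bohr_root_unique (P : R -> Prop) :
  (forall x, 0 < x < 1 ->
     P x <-> sup_eq1 (fun N => \sum_(1 <= n < N) bohr_term eta x n)) ->
  exists x0 : R, unique (fun x => 0 < x < 1 /\ P x) x0 /\
    forall r, 0 < r < 1 -> x0 < r -> exists M, 1 < \sum_(1 <= n < M) bohr_term eta r n.
Proof.
move=> hP; have [x0 x01 hx0] := bohr_root_exists eta1.
have above r : 0 < r < 1 -> x0 < r ->
    exists M, 1 < \sum_(1 <= n < M) bohr_term eta r n.
  by move=> /andP[_ r1] xr; case/andP: x01 => x00 _; exact: bohr_sum_gt1 xr r1 hx0.
exists x0; split=> //; split; first by split=> //; apply/hP.
move=> y [y01 /(hP _ y01) hy]; case: (ltgtP x0 y) => // [xy|yx].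
  by have [M] := above y y01 xy; rewrite ltNge => /negP[]; apply: hy.1.
have [||M] := bohr_sum_gt1 eta1 _ yx _ hy; [by case/andP: y01|by case/andP: x01|].
by rewrite ltNge => /negP[]; apply: hx0.1.
Qed.

End bohr_equation.

Lemma bohr_series1 (R : realType) (x : R) : 0 < x < 1 ->
  (\sum_(1 <= n <oo) (4 * x ^+ n / (1 + x ^+ (2 * n)))%:E = 1)%E <->
  sup_eq1 (fun N => \sum_(1 <= n < N) bohr_term 1 x n).
Proof.
move=> /andP[x0 x1]; rewrite -nneseries_eq1 => [|n n0].
  rewrite (@eq_eseriesr _ _ (fun n => (bohr_term 1 x n)%:E)) // => n _.
  by rewrite /bohr_term expr1n mul1r.
by apply: bohr_term_ge0; rewrite ?normr1 ?(ltW x0).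
Qed.

(** The terms are nonnegative, so the series may be split by the parity of n, which determines the
    sign (-1)^n in the denominator. *)
Lemma bohr_seriesN1 (R : realType) (x : R) : 0 < x < 1 ->
  (\sum_(1 <= n <oo | ~~ odd n) (4 * x ^+ n / (1 + x ^+ (2 * n)))%:E
   + \sum_(1 <= n <oo | odd n) (4 * x ^+ n / (1 - x ^+ (2 * n)))%:E = 1)%E <->
  sup_eq1 (fun N => \sum_(1 <= n < N) bohr_term (-1) x n).
Proof.
move=> /andP[x0 x1].
have t0 n : (1 <= n)%N -> 0 <= bohr_term (-1) x n.
  by move=> n0; apply: bohr_term_ge0; rewrite ?normrN ?normr1 ?(ltW x0).
have t0E n : (1 <= n)%N -> (0 <= (bohr_term (-1) x n)%:E)%E by rewrite lee_fin; exact: t0.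
rewrite -nneseries_eq1//.
have -> : (\sum_(1 <= n <oo) (bohr_term (-1) x n)%:E =
  \sum_(1 <= n <oo | ~~ odd n) (bohr_term (-1) x n)%:E +
  \sum_(1 <= n <oo | odd n) (bohr_term (-1) x n)%:E)%E.
  rewrite [X in _ = (X + _)%E]eseries_mkcond [X in _ = (_ + X)%E]eseries_mkcond.
  rewrite -nneseriesD => [|n n0 _|n n0 _].
  - apply: eq_eseriesr => n _; by case: odd; rewrite ?add0e ?adde0.
  - by case: ifP => // _; exact: t0E.
  - by case: ifP => // _; exact: t0E.
rewrite (@eq_eseriesr _ _ (fun n => (bohr_term (-1) x n)%:E) (fun n => ~~ odd n)) => [|n on].
rewrite (@eq_eseriesr _ _ (fun n => (bohr_term (-1) x n)%:E) odd) => [//|n on].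
  by rewrite /bohr_term -signr_odd on expr1 mulN1r.
by rewrite /bohr_term -signr_odd (negPf on) expr0 mul1r.
Qed.

Theorem theorem5p4 (R : realType) :
  exists R1 R0 : R,
    [/\ unique (fun x : R => 0 < x < 1 /\
          (\sum_(1 <= n <oo) (4 * x ^+ n / (1 + x ^+ (2 * n)))%:E = 1)%E) R1,
        unique (fun x : R => 0 < x < 1 /\
          (\sum_(1 <= n <oo | ~~ odd n) (4 * x ^+ n / (1 + x ^+ (2 * n)))%:E
           + \sum_(1 <= n <oo | odd n) (4 * x ^+ n / (1 - x ^+ (2 * n)))%:E
           = 1)%E) R0
      & forall r : R, 0 < r < 1 ->
          (R1 < r -> ~ bohr_phenomenon r (real_coefficients_class r)) /\
          (R0 < r -> ~ bohr_phenomenon r (holomorphic_class r))].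
Proof.
have n1 : `|1 : R| <= 1 by rewrite normr1.
have nN1 : `|-1 : R| <= 1 by rewrite normrN normr1.
have [R1 [uR1 hR1]] := bohr_root_unique n1 (@bohr_series1 R).
have [R0 [uR0 hR0]] := bohr_root_unique nN1 (@bohr_seriesN1 R).
exists R1, R0; split=> // r r01; split=> hr.
  apply: (@not_bohr_phenomenon R r r01 1 1); rewrite ?expr1n ?normc1//; last exact: hR1.
  move=> f a hf fa aE; split=> //; exists a => // n.
  by have [c ->] := aE n; rewrite expr1n mulr1; apply/complex_realP; exists c.
apply: (@not_bohr_phenomenon R r r01 (-1) (- 'i)); rewrite ?normcN ?normc_i//.
- by rewrite sqrrN expr1n.
- by rewrite sqrrN sqr_i rmorphN rmorph1.
- exact: hR0.
Qed.
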